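(* Let $d\ge 2$ be an even integer. For the problem on the network $\mathscr{G}_d$ in which each $w_i$ ($i\in\{0,1,2\}$) receives an input bit $b_i$ and each $v_j$ ($j\in\{0,\dots,3d-1\}$) must output a bit $x_j$ such that $(x_0,\dots,x_{3d-1})\in\Lambda_d(b_0,b_1,b_2)$: there exists a $2$-round quantum LOCAL algorithm that always outputs a valid string; and for any integer $T\le d/2$, no $T$-round classical LOCAL algorithm can output a valid string with probability greater than $7/8$ on all inputs $(b_0,b_1,b_2)\in\{0,1\}^3$, even if arbitrary prior randomness shared among the nodes is allowed.
   Context: For even $d\ge2$, $G_d$ is the cycle on nodes $v_0,v_1,\dots,v_{3d-1}$ with edges $\{v_j,v_{j+1}\}$ (indices mod $3d$). The network $\mathscr{G}_d$ has node set $\{v_0,\dots,v_{3d-1}\}\cup\{w_0,w_1,w_2\}$ and the edges of $G_d$ together with $\{v_0,w_0\},\{v_d,w_1\},\{v_{2d},w_2\}$. Graph state of a graph: one qubit register per node initialized to $|0\rangle$, Hadamard $\mathrm{H}=\frac1{\sqrt2}\begin{pmatrix}1&1\\1&-1\end{pmatrix}$ applied to each, then $\mathrm{CZ}=\mathrm{diag}(1,1,1,-1)$ applied to each pair of registers forming an edge. For bits $b_0,b_1,b_2$ the process $\mathscr{P}_d(b_0,b_1,b_2)$ is: (1) create the graph state of $G_d$; (2) for each $i\in\{0,1,2\}$ apply $\mathrm{S}^{b_i}$ to the qubit of $v_{di}$, where $\mathrm{S}=\mathrm{diag}(1,i)$; (3) apply $\mathrm{H}$ to every qubit; (4) measure all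 qubits in the computational basis, obtaining $m\in\{0,1\}^{3d}$ whose $j$-th bit is the outcome at $v_j$. $\Lambda_d(b_0,b_1,b_2)\subseteq\{0,1\}^{3d}$ is the set of outcomes occurring with nonzero probability. LOCAL model: synchronous rounds, each node (with distinct identifier, knowing its incident edges and the number of nodes) may do arbitrary local computation and send one unbounded-size message per neighbour per round; classical: probabilistic processors and classical messages; quantum: quantum processors and quantum messages; no initial shared entanglement (and, unless stated, no shared randomness). *)

(* Defs.v *)
From HB Require Import structures.
From mathcomp Require Import all_boot all_order all_algebra.
From mathcomp Require Import all_classical all_reals all_analysis.
From mathcomp.real_closed Require Import complex.
Set Implicit Arguments. Unset Strict Implicit. Unset Printing Implicit Defensive.
Import Order.TTheory GRing.Theory Num.Theory.
Local Open Scope ring_scope.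

(* The network  G_d (script G_d): nodes v_0..v_{3d-1} (inl j) and w_0,w_1,w_2 *)
(* (inr i); edges {v_j, v_{j+1 mod 3d}} and {v_{d i}, w_i}.                   *)
Notation node d := ('I_(3 * d) + 'I_3)%type.

Definition cyc_adj (n j k : nat) : bool :=
  (k == j.+1 %% n)%N || (j == k.+1 %% n)%N.

Definition netadj (d : nat) (x y : node d) : bool :=
  match x, y with
  | inl j, inl k => cyc_adj (3 * d) j k
  | inl j, inr i => (nat_of_ord j == d * i)%N
  | inr i, inl j => (nat_of_ord j == d * i)%N
  | inr _, inr _ => false
  end.

Definition loc_input (d : nat) (b : {ffun 'I_3 -> bool}) (x : node d) : option bool :=
  match x with inl _ => None | inr i => Some (b i) end.

Section Quantum.
Variable R : realType.
Local Notation C := R[i].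

Definition qvec (n : nat) := {ffun 'I_n -> bool} -> C.

Definition setbit n (x : {ffun 'I_n -> bool}) (k : 'I_n) (a : bool) :
  {ffun 'I_n -> bool} := [ffun j => if j == k then a else x j].

Definition gate1 n (U : bool -> bool -> C) (k : 'I_n) (psi : qvec n) : qvec n :=
  fun x => \sum_(a : bool) U (x k) a * psi (setbit x k a).

Definition gateCZ n (j k : 'I_n) (psi : qvec n) : qvec n :=
  fun x => (if x j && x k then -1 else 1) * psi x.

Definition Hgate : bool -> bool -> C :=
  fun a c => (if a && c then -1 else 1) / (Num.sqrt (2 : R))%:C%C.
Definition Sgate : bool -> bool -> C :=
  fun a c => if a == c then (if a then 'i%C else 1) else 0.

Definition ket0 n : qvec n := fun x => if x == [ffun => false] then 1 else 0.
Arguments ket0 : clear implicits.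

Definition H_all n (psi : qvec n) : qvec n := foldr (gate1 Hgate) psi (enum 'I_n).

Definition graph_state n (e : rel 'I_n) : qvec n :=
  foldr (fun p psi => gateCZ p.1 p.2 psi) (H_all (ket0 n))
    [seq p <- [seq (j, k) | j <- enum 'I_n, k <- enum 'I_n]
       | (nat_of_ord p.1 < nat_of_ord p.2)%N && e p.1 p.2].

Definition Gd_adj (d : nat) : rel 'I_(3 * d) := fun j k => cyc_adj (3 * d) j k.

Arguments Gd_adj : clear implicits.

Definition Pd_state (d : nat) (b : {ffun 'I_3 -> bool}) : qvec (3 * d) :=
  H_all (foldr (gate1 Sgate) (graph_state (Gd_adj d))
    [seq j <- enum 'I_(3 * d) | [exists i : 'I_3, (nat_of_ord j == d * i)%N && b i]]).

Arguments Pd_state : clear implicits.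

Definition Lambda (d : nat) (b : {ffun 'I_3 -> bool}) : {set {ffun 'I_(3 * d) -> bool}} :=
  [set m | `|Pd_state d b m| ^+ 2 != 0].
Arguments Lambda : clear implicits.

(* Quantum LOCAL algorithms on G_d (purified form: local isometries, quantum *)
(* messages, no initial entanglement, final measurement).                    *)
(* Before round t (0-based), node u holds register qReg u t; in round t it   *)
(* applies an isometry (depending on u, t and its local input) from          *)
(* qReg u t to (memory qM u t.+1) (x) (outgoing messages qMsg u w t for each *)
(* w); messages to non-neighbours are trivial (dimension 1).  The register   *)
(* after round t is (memory) (x) (incoming messages).                        *)
Fixpoint qReg (V : finType) (M : V -> nat -> finType) (Msg : V -> V -> nat -> finType)
  (u : V) (t : nat) : finType :=
  match t with
  | 0 => unit
  | t'.+1 => (M u t * {dffun forall w : V, Msg w u t'})%type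
  end.

Record qalg (d T : nat) := QAlg {
  qM : node d -> nat -> finType;
  qMsg : node d -> node d -> nat -> finType;
  qO : node d -> finType;
  qMsg_triv : forall u w t, ~~ netadj u w -> #|qMsg u w t| = 1%N;
  qK : forall (u : node d) (t : nat), option bool ->
         (qM u t.+1 * {dffun forall w : node d, qMsg u w t})%type ->
         qReg qM qMsg u t -> C;
  qK_iso : forall u t x, (t < T)%N -> forall a a' : qReg qM qMsg u t,
      \sum_o (@qK u t x o a)^* * @qK u t x o a' = (a == a')%:R;
  qF : forall (u : node d), option bool -> qO u -> qReg qM qMsg u T -> C;
  qF_iso : forall u x, forall a a' : qReg qM qMsg u T,
      \sum_o (@qF u x o a)^* * @qF u x o a' = (a == a')%:R;
  qout : forall u : node d, qO u -> bool
}.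

Fixpoint qglobal d T (A : qalg d T) (b : {ffun 'I_3 -> bool}) (t : nat) :
  {dffun forall u : node d, qReg (qM A) (qMsg A) u t} -> C :=
  match t as t0 return {dffun forall u : node d, qReg (qM A) (qMsg A) u t0} -> C with
  | 0 => fun _ => 1
  | t'.+1 => fun g' =>
      \sum_(g : {dffun forall u : node d, qReg (qM A) (qMsg A) u t'})
        (\prod_(u : node d) @qK _ _ A u t' (loc_input b u)
            ((g' u).1, [ffun w => (g' w).2 u]) (g u)) * @qglobal d T A b t' g
  end.
Arguments qglobal {d T} A b t _.

Definition qfinal d T (A : qalg d T) (b : {ffun 'I_3 -> bool})
  (o : {dffun forall u : node d, qO A u}) : C :=
  \sum_(g : {dffun forall u : node d, qReg (qM A) (qMsg A) u T})
    (\prod_(u : node d) @qF _ _ A u (loc_input b u) (o u) (g u)) * qglobal A b T g.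
Arguments qfinal {d T} A b o.

Definition qoutput d T (A : qalg d T) (o : {dffun forall u : node d, qO A u}) :
  {ffun 'I_(3 * d) -> bool} := [ffun j => @qout _ _ A (inl j) (o (inl j))].
Arguments qoutput {d T} A o.

Definition qfail_prob d T (A : qalg d T) (b : {ffun 'I_3 -> bool}) : C :=
  \sum_(o | qoutput A o \notin Lambda d b) `|qfinal A b o| ^+ 2.
Arguments qfail_prob {d T} A b.

End Quantum.

(* Classical (randomized) LOCAL algorithms on G_d with T rounds, with        *)
(* arbitrary prior randomness: omega : Omega is the random seed; each node's  *)
(* private and shared random bits are arbitrary functions of omega.          *)
Record calg (d : nat) (Omega : Type) (T : nat) := CAlg {
  cS : node d -> nat -> Type;
  cMsg : node d -> node d -> nat -> Type;
  cinit : forall u : node d, option bool -> Omega -> cS u 0;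
  csend : forall (u w : node d) (t : nat), cS u t -> cMsg u w t;
  cupd : forall (u : node d) (t : nat), cS u t ->
           (forall w : node d, option (cMsg w u t)) -> cS u t.+1;
  cout : forall u : node d, cS u T -> bool
}.

Fixpoint cstate d Omega T (A : calg d Omega T) (b : {ffun 'I_3 -> bool}) (om : Omega)
  (t : nat) : forall u : node d, cS A u t :=
  match t as t0 return forall u : node d, cS A u t0 with
  | 0 => fun u => @cinit d Omega T A u (loc_input b u) om
  | t'.+1 => fun u => @cupd d Omega T A u t' (@cstate d Omega T A b om t' u)
      (fun w => if netadj w u
                then Some (@csend d Omega T A w u t' (@cstate d Omega T A b om t' w))
                else None)
  end.
Arguments cstate {d Omega T} A b om t u.

Definition coutput d Omega T (A : calg d Omega T) (b : {ffun 'I_3 -> bool}) (om : Omega) :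
  {ffun 'I_(3 * d) -> bool} := [ffun j => @cout d Omega T A (inl j) (cstate A b om T (inl j))].
Arguments coutput {d Omega T} A b om.

Definition csuccess (R : realType) d Omega T (A : calg d Omega T)
  (b : {ffun 'I_3 -> bool}) : set Omega := [set om | coutput A b om \in Lambda R d b].
Arguments csuccess R {d Omega T} A b.

(* Main.v *)
Require Import Defs.
From HB Require Import structures.
From mathcomp Require Import all_boot all_order all_algebra.
From mathcomp Require Import all_classical all_reals all_analysis.
From mathcomp.real_closed Require Import complex.
From mathcomp Require Import zify ring lra.
Import Order.TTheory GRing.Theory Num.Theory.
Local Open Scope ring_scope.

(** Quantum part: every node prepares its qubit and sends a basis-state copy of
    it to each neighbour; a node holding copies of its neighbours' qubits can
    apply CZ (and [w_i], which knows [b_i], can apply S) as a phase, after which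
    the copies are returned and erased.  The amplitudes are then, up to a
    constant, those of the process.

    Classical part: a product of graph state stabilizers that is a product of
    measured observables forces a parity of the outcomes.  On every input the
    odd nodes have parity 0; on input 000 the even nodes have parity 0; and if
    exactly two bits are 1, the even nodes together with the odd nodes between
    the two corresponding corners have parity 1.  With [T <= d/2] each output
    depends on at most one input bit, and an output between two corners does not
    depend on the third bit.  The constraints for 000, 111 and the three inputs
    of weight two then sum to 1, while every node contributes 0.  So each random
    seed fails on one of the eight inputs. *)

(** * Amplitudes of the process *)

Section Amplitude.
Context {R : realType}.
Local Notation C := R[i].

Lemma prod_indicator (S : comPzSemiRingType) (I : finType) (P : pred I) :
  \prod_i (P i)%:R = [forall i, P i]%:R :> S.
Proof.
rewrite -natr_prod; congr (_ %:R).
apply/eqP; case: (boolP [forall i, P i]) => [/forallP PT | /forallPn [i nPi]].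
  by rewrite big1 // => i _; rewrite PT.
by rewrite (bigD1 i) //= (negbTE nPi) mul0n.
Qed.

Lemma dffun_eqE (I : finType) (T : I -> eqType) (f g : {dffun forall i, T i}) :
  (f == g) = [forall i, f i == g i].
Proof.
apply/eqP/forallP => [-> // | fg].
by apply/ffunP => i; apply/eqP.
Qed.

Lemma foldr_gate1E n (U : bool -> bool -> C) (s : seq 'I_n) (psi : qvec R n) m :
  uniq s ->
  foldr (gate1 U) psi s m =
  \sum_(x : {ffun _}) (\prod_j if j \in s then U (m j) (x j) else (x j == m j)%:R) * psi x.
Proof.
elim: s m => [|k s IHs] m /=.
  move=> _; rewrite (bigD1 m) //= big1 => [|j _]; last by rewrite eqxx.
  rewrite mul1r big1 ?addr0 // => x /negbTE nxm.
  by rewrite prod_indicator -dffun_eqE nxm mul0r.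
case/andP => ks us; rewrite {1}/gate1.
under [LHS]eq_bigr => a _ do rewrite IHs // big_distrr.
rewrite exchange_big; apply: eq_bigr => x _ /=.
under [LHS]eq_bigr => a _ do rewrite mulrA (bigD1 k) //= (negbTE ks) ffunE eqxx.
rewrite -big_distrl /=; congr (_ * _).
rewrite [RHS](bigD1 k) //= inE eqxx /=.
under eq_bigr => a _.
  under eq_bigr => j jk do rewrite ffunE (negbTE jk).
  over.
under [in RHS]eq_bigr => j jk do rewrite inE (negbTE jk) /=.
by rewrite big_bool /=; case: (x k); rewrite /= !(mul0r, mul1r, mulr0, addr0, add0r).
Qed.

Lemma H_allE n (psi : qvec R n) m :
  H_all psi m = \sum_(x : {ffun _}) (\prod_j Hgate R (m j) (x j)) * psi x.
Proof.
rewrite /H_all foldr_gate1E ?enum_uniq //.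
apply: eq_bigr => x _; congr (_ * _).
by apply: eq_bigr => j _; rewrite mem_enum.
Qed.

Lemma foldr_SgateE n (s : seq 'I_n) (psi : qvec R n) x :
  foldr (gate1 (Sgate R)) psi s x =
  (\prod_(j <- s) if x j then 'i%C else 1) * psi x.
Proof.
elim: s => [|k s IHs] /=; first by rewrite big_nil mul1r.
have setbit_id : setbit x k (x k) = x.
  by apply/ffunP => j; rewrite ffunE; case: eqP => // ->.
rewrite big_cons -mulrA -IHs {1}/gate1 big_bool /Sgate.
by case E: (x k); rewrite /= -{1}E setbit_id ?mul0r ?add0r ?addr0.
Qed.

Lemma foldr_gateCZE n (s : seq ('I_n * 'I_n)) (psi : qvec R n) x :
  foldr (fun p psi => gateCZ p.1 p.2 psi) psi s x =
  (\prod_(p <- s) if x p.1 && x p.2 then -1 else 1) * psi x.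
Proof.
elim: s => [|p s IHs] /=; first by rewrite big_nil mul1r.
by rewrite big_cons -mulrA -IHs {1}/gateCZ.
Qed.

(** Each edge is charged to its larger endpoint, the way node v_k applies it in the quantum
    algorithm ([phase]). *)
Definition CZ_phase {d} (x : {ffun 'I_(3 * d) -> bool}) : C :=
  \prod_(k : 'I_(3 * d)) \prod_(j : 'I_(3 * d) | (j < k)%N && @Gd_adj d j k)
    if x k && x j then -1 else 1.

Definition S_phase {d} (b : {ffun 'I_3 -> bool}) (x : {ffun 'I_(3 * d) -> bool}) : C :=
  \prod_(i : 'I_3) \prod_(j : 'I_(3 * d) | nat_of_ord j == (d * i)%N)
    if b i && x j then 'i%C else 1.

(** The amplitude of [m] without the constant from the Hadamards that create the graph state. *)
Definition amp {d} (b : {ffun 'I_3 -> bool}) (m : {ffun 'I_(3 * d) -> bool}) : C :=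
  \sum_(x : {ffun _}) (\prod_j Hgate R (m j) (x j)) * (S_phase b x * CZ_phase x).

Lemma graph_stateE d x :
  graph_state R (@Gd_adj d) x =
  (Num.sqrt (2 : R))%:C%C^-1 ^+ (3 * d) * CZ_phase x.
Proof.
rewrite /graph_state foldr_gateCZE mulrC; congr (_ * _).
  rewrite H_allE (bigD1 [ffun=> false]) //= [X in _ + X]big1 => [|y /negbTE ny].
    rewrite /ket0 eqxx mulr1 addr0 -[in RHS](card_ord (3 * d)) -prodr_const.
    by apply: eq_bigr => j _; rewrite ffunE /Hgate andbF mul1r.
  by rewrite /ket0 ny mulr0.
rewrite big_filter big_mkcond big_allpairs_dep /= big_enum /=.
rewrite /CZ_phase [RHS](exchange_big_dep predT) //=.
apply: eq_bigr => j _; rewrite big_enum [RHS]big_mkcond.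
by apply: eq_bigr => k _; rewrite [x k && _]andbC.
Qed.

Definition rotated {d} (b : {ffun 'I_3 -> bool}) (j : 'I_(3 * d)) : bool :=
  [exists i : 'I_3, (nat_of_ord j == d * i)%N && b i].

Lemma S_phase_rotated d (b : {ffun 'I_3 -> bool}) (x : {ffun 'I_(3 * d) -> bool}) :
  (0 < d)%N ->
  S_phase b x = \prod_(j | rotated b j) if x j then 'i%C else 1.
Proof.
move=> d0; rewrite /S_phase (exchange_big_dep predT) //= [RHS]big_mkcond.
apply: eq_bigr => j _.
case: ifP => [/existsP[i /andP[/eqP ji bi]] | /negbT/existsPn nb].
  rewrite (bigD1 i) ?ji //= bi big1 ?mulr1 // => k /andP[/eqP].
  move=> /eqP; rewrite eqn_mul2l eqn0Ngt d0 /= => /eqP ik; case/eqP.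
  exact/val_inj.
rewrite big1 // => i ji; have := nb i; rewrite ji /=.
by case: (b i).
Qed.

Lemma Pd_stateE d b (m : {ffun 'I_(3 * d) -> bool}) : (0 < d)%N ->
  Pd_state R b m = (Num.sqrt (2 : R))%:C%C^-1 ^+ (3 * d) * amp b m.
Proof.
move=> d0; rewrite /Pd_state H_allE big_distrr; apply: eq_bigr => x _ /=.
rewrite foldr_SgateE graph_stateE big_filter big_enum_cond.
by rewrite S_phase_rotated // [RHS]mulrCA; congr (_ * _); rewrite mulrCA.
Qed.

Lemma sqrt2_neq0 : (Num.sqrt (2 : R))%:C%C != 0 :> C.
Proof. by rewrite fmorph_eq0 sqrtr_eq0 -ltNge ltr0n. Qed.

Lemma LambdaE d b (m : {ffun 'I_(3 * d) -> bool}) :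
  (0 < d)%N -> (m \in @Lambda R d b) = (amp b m != 0).
Proof.
move=> d0; rewrite inE sqrf_eq0 normr_eq0 Pd_stateE // mulf_eq0.
by rewrite expf_eq0 invr_eq0 (negbTE sqrt2_neq0) andbF.
Qed.

End Amplitude.

(** * Parity constraints *)

Lemma val_ordS n (j : 'I_n) : ordS j = (if j.+1 == n then 0 else j.+1)%N :> nat.
Proof.
rewrite /=; case: eqP => [-> | jn]; first exact: modnn.
by rewrite modn_small //; have := ltn_ord j; lia.
Qed.

Lemma big_addb_ordS n (f : 'I_n -> bool) :
  \big[addb/false]_j f (ordS j) = \big[addb/false]_j f j.
Proof. by rewrite [RHS](reindex_inj (@ordS_inj n)). Qed.

Section Cycle.
Context {d : nat}.
Hypothesis d_even : ~~ odd d.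

Lemma odd_ordS (j : 'I_(3 * d)) : odd (ordS j) = ~~ odd j.
Proof.
rewrite val_ordS; case: eqP => // jd.
by have := congr1 odd jd; rewrite /= oddM /= (negbTE d_even) => /negbFE ->.
Qed.

Lemma odd_ord_pred (j : 'I_(3 * d)) : odd (ord_pred j) = ~~ odd j.
Proof. by rewrite -{2}(ord_predK j) odd_ordS negbK. Qed.

Lemma even_rotated b (j : 'I_(3 * d)) : rotated b j -> ~~ odd j.
Proof. by case/existsP => i /andP[/eqP -> _]; rewrite oddM (negbTE d_even). Qed.

End Cycle.

(** * Stabilizer relations on the cycle *)

Section Relations.
Context {R : realType} {d : nat}.
Hypotheses (d_ge2 : (2 <= d)%N) (d_even : ~~ odd d).
Local Notation C := R[i].

Lemma prodr_sign (I : finType) (P : pred I) (f : I -> bool) :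
  \prod_(i | P i) (-1) ^+ f i = (-1) ^+ (\big[addb/false]_(i | P i) f i) :> C.
Proof.
by symmetry; apply: (big_morph (fun b : bool => (-1) ^+ b : C) (@signr_addb _)).
Qed.

(** As 3d > 2, every edge is {j, j+1} for exactly one j. Its larger endpoint is j+1, except for the
    edge that wraps around to v_0. *)
Lemma CZ_phaseE (x : {ffun 'I_(3 * d) -> bool}) :
  CZ_phase x = (-1) ^+ (\big[addb/false]_j (x j && x (ordS j))) :> C.
Proof.
have d3 : (2 < 3 * d)%N by lia.
pose f (k j : 'I_(3 * d)) : C := if x k && x j then -1 else 1.
have fC k j : f k j = f j k by rewrite /f andbC.
have -> : CZ_phase x =
  \prod_(k : 'I_(3 * d))
    (\prod_(j : 'I_(3 * d) | (j < k)%N && (k == ordS j)) f k j *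
     \prod_(j : 'I_(3 * d) | (j < k)%N && (j == ordS k)) f k j).
  apply: eq_bigr => k _; rewrite (bigID (fun j => k == ordS j)) /=.
  have adjE j : @Gd_adj d j k = (k == ordS j) || (j == ordS k) by [].
  have nE j : (k == ordS j) && (j == ordS k) = false.
    apply/negP => /andP[/eqP/(congr1 val)/= kj /eqP/(congr1 val)/= jk].
    have := val_ordS _ j; have := val_ordS _ k; rewrite /= -kj -jk.
    by have := ltn_ord k; have := ltn_ord j; do 2!case: eqP; lia.
  congr (_ * _); apply: eq_bigl => j; rewrite adjE; have := nE j;
    by case: (_ < _)%N => //=; case: (k == _); case: (j == _).
rewrite big_split /= (exchange_big_dep predT) //= -big_split /= -prodr_sign.
apply: eq_bigr => j _; rewrite !big_mkcondl !big_pred1_eq fC.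
have -> : (-1) ^+ (x j && x (ordS j)) = f j (ordS j) by rewrite /f; case: (_ && _).
case: (ltngtP j (ordS j)) => jj; rewrite ?mulr1 ?mul1r //.
by have := ltn_ord j; have := val_ordS _ j; rewrite -jj; case: eqP; lia.
Qed.

Definition shift {n} (s x : {ffun 'I_n -> bool}) : {ffun 'I_n -> bool} :=
  [ffun j => x j (+) s j].

Lemma shiftK n (s : {ffun 'I_n -> bool}) : involutive (shift s).
Proof. by move=> x; apply/ffunP => j; rewrite !ffunE -addbA addbb addbF. Qed.

(** Qubit by qubit, i^(x xor s) = i^x i^s (-1)^(x s). *)
Lemma S_phase_shift b (s x : {ffun 'I_(3 * d) -> bool}) :
  S_phase b (shift s x) =
  S_phase b x * S_phase b s *
  (-1) ^+ (\big[addb/false]_j (x j && (rotated b j && s j))) :> C.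
Proof.
have d0 : (0 < d)%N by lia.
have -> : \big[addb/false]_j (x j && (rotated b j && s j)) =
          \big[addb/false]_(j | rotated b j) (x j && s j).
  by rewrite [RHS]big_mkcond; apply: eq_bigr => j _; case: ifP; rewrite ?andbF.
rewrite !S_phase_rotated // -prodr_sign -!big_split /=.
apply: eq_bigr => j _; rewrite ffunE.
by case: (x j); case: (s j); rewrite /= ?mulr1 ?mul1r // -expr2 sqr_i mulrN1 opprK.
Qed.

(** Polarization over F_2 of the quadratic form summing x_j x_{j+1}: the cross terms pair x_j with
    [s] at both neighbours of j. *)
Lemma CZ_phase_shift (s x : {ffun 'I_(3 * d) -> bool}) :
  CZ_phase (shift s x) =
  CZ_phase x * CZ_phase s *
  (-1) ^+ (\big[addb/false]_j (x j && (s (ord_pred j) (+) s (ordS j)))) :> C.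
Proof.
rewrite !CZ_phaseE -!signr_addb; congr (_ ^+ nat_of_bool _).
transitivity (\big[addb/false]_j
   ((x j && x (ordS j)) (+) (s j && s (ordS j)) (+)
    (x j && s (ordS j)) (+) (s j && x (ordS j)))).
  apply: eq_bigr => j _; rewrite !ffunE.
  by case: (x j); case: (s j); case: (x _); case: (s _).
rewrite !big_split /= -!addbA; do 2!congr (_ (+) _).
have -> : \big[addb/false]_j (s j && x (ordS j)) =
          \big[addb/false]_j (s (ord_pred j) && x j).
  rewrite -[RHS]big_addb_ordS.
  by apply: eq_bigr => j _; rewrite ordSK.
rewrite -big_split; apply: eq_bigr => j _ /=.
by case: (x j); rewrite ?andbF ?andbT // addbC.
Qed.

Lemma H_shift (s x m : {ffun 'I_(3 * d) -> bool}) :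
  \prod_j Hgate R (m j) (shift s x j) =
  (\prod_j Hgate R (m j) (x j)) *
  (-1) ^+ (\big[addb/false]_j (m j && s j)).
Proof.
rewrite -prodr_sign -big_split /=; apply: eq_bigr => j _.
rewrite ffunE /Hgate mulrAC; congr (_ * _).
by case: (m j); case: (s j); case: (x j); rewrite /= ?mulr1 ?mul1r ?mulrNN ?mulr1.
Qed.

(* [s] selects the product of the stabilizer generators at its support; the
   hypothesis says that this product is, up to a sign, a product of measured
   observables, and the conclusion is the resulting constraint on outcomes. *)
Lemma amp_stabilizer b (s m : {ffun 'I_(3 * d) -> bool}) :
  (forall j, s (ord_pred j) (+) s (ordS j) = rotated b j && s j) ->
  amp b m != 0 :> C ->
  (-1) ^+ (\big[addb/false]_j (m j && s j)) * (S_phase b s * CZ_phase s) = 1 :> C.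
Proof.
move=> stab_s amp_n0; apply/eqP.
rewrite -subr_eq0; have := amp_n0; apply: contraNT.
set c : C := (-1) ^+ _ * (_ * _) => c_n0.
suff Ec : amp b m = c * amp b m :> C.
  move/eqP: Ec; rewrite -{1}[amp b m]mul1r -subr_eq0 -mulrBl mulf_eq0 subr_eq0.
  by rewrite [1 == c]eq_sym -subr_eq0 (negbTE c_n0).
(* Translating the summation variable by [s] multiplies each summand by [c]: by [stab_s] the
   cross-term signs of S and CZ are equal and cancel. *)
rewrite /amp [LHS](reindex_inj (inv_inj (shiftK _ s))) big_distrr /=.
apply: eq_bigr => x _.
rewrite H_shift S_phase_shift CZ_phase_shift.
under [\big[addb/false]_j (x j && (s _ (+) _))]eq_bigr do rewrite stab_s.
set e := \big[addb/false]_j (x j && _).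
set P := \prod_j _; set Sx := S_phase b x; set Cx := CZ_phase x.
rewrite /c; set sm := _ ^+ _; set Ss := S_phase b s; set Cs := CZ_phase s.
have ee : (-1) ^+ e * (-1) ^+ e = 1 :> C by rewrite -signr_addb addbb.
transitivity (sm * (Ss * Cs) * (P * (Sx * Cx)) * ((-1) ^+ e * (-1) ^+ e)).
  by rewrite -!mulrA; ring.
by rewrite ee mulr1.
Qed.

(** The stabilizer product over the odd nodes: every even node has two odd neighbours, so the Z
    factors cancel. No odd node is rotated and no two are adjacent, so the sign is +1. *)
Lemma odd_parity b (m : {ffun 'I_(3 * d) -> bool}) :
  amp b m != 0 :> C -> \big[addb/false]_j (m j && odd j) = false.
Proof.
pose s := [ffun j : 'I_(3 * d) => odd j].
have s_rot j : rotated b j -> s j = false.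
  by move=> /(even_rotated d_even)/negbTE; rewrite ffunE.
move=> /(amp_stabilizer b s) H.
have /H : forall j, s (ord_pred j) (+) s (ordS j) = rotated b j && s j.
  move=> j; rewrite !ffunE odd_ordS // odd_ord_pred // addbb.
  by case: (boolP (rotated b j)) => //= /s_rot; rewrite ffunE.
rewrite S_phase_rotated; last lia.
rewrite [\prod_(j | rotated _ j) _]big1 => [|j /s_rot -> //]; rewrite mul1r CZ_phaseE.
rewrite [X in _ * (-1) ^+ nat_of_bool X]big1 => [|j _]; last first.
  by rewrite !ffunE odd_ordS // andbN.
rewrite mulr1 => Hm.
have -> : \big[addb/false]_j (m j && odd j) = \big[addb/false]_j (m j && s j).
  by apply: eq_bigr => j _; rewrite ffunE.
by apply: contra_eqF Hm => ->; rewrite -subr_eq0 -opprD oppr_eq0 -[1 + 1]/(2%:R) pnatr_eq0.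
Qed.

(** Here [o] is a set of odd nodes whose boundary, mod 2, is the set of rotated corners. In the
    stabilizer product over the even nodes and [o], a Z survives exactly at those corners, where XZ
    is the measured observable up to a phase. *)
Lemma even_parity b (o : pred 'I_(3 * d)) (m : {ffun 'I_(3 * d) -> bool}) :
  (forall j, o j -> odd j) ->
  (forall j, o (ord_pred j) (+) o (ordS j) = rotated b j) ->
  amp b m != 0 :> C ->
  (-1) ^+ (\big[addb/false]_j (m j && (~~ odd j (+) o j))) *
    (\prod_i if b i then 'i%C else 1) = 1 :> C.
Proof.
move=> o_odd o_rot.
pose s := [ffun j : 'I_(3 * d) => ~~ odd j (+) o j].
have s_even (j : 'I_(3 * d)) : ~~ odd j -> s j.
  move=> ej; rewrite ffunE ej; case: (boolP (o j)) => // /o_odd.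
  by rewrite (negbTE ej).
move=> /(amp_stabilizer b s) H.
have /H : forall j, s (ord_pred j) (+) s (ordS j) = rotated b j && s j.
  move=> j; rewrite -o_rot !ffunE odd_ordS // odd_ord_pred // negbK.
  rewrite addbACA addbb /= o_rot.
  case: (boolP (rotated b j)) => //= /(even_rotated d_even)/s_even.
  by rewrite ffunE => ->.
(* An edge inside the support has its odd endpoint in [o], and each node of [o] lies on two such
   edges, so their number is even. *)
have -> : CZ_phase s = 1 :> C.
  rewrite CZ_phaseE.
  transitivity ((-1) ^+ (\big[addb/false]_j (o j (+) o (ordS j))) : C).
    congr (_ ^+ nat_of_bool _); apply: eq_bigr => j _; rewrite !ffunE odd_ordS //.
    have := o_odd j; have := o_odd (ordS j); rewrite odd_ordS //.
    by case: (odd j) => /=; case: (o j) => /=; case: (o _) => //= h1 h2;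
      first [have := h1 isT | have := h2 isT].
  by rewrite big_split /= big_addb_ordS addbb.
have -> : S_phase b s = \prod_i (if b i then 'i%C else 1) :> C.
  apply: eq_bigr => i _.
  have id : (d * i < 3 * d)%N by have := ltn_ord i; nia.
  rewrite (big_pred1 (Ordinal id)) => [|j //].
  by rewrite s_even ?andbT //= oddM (negbTE d_even).
rewrite mulr1 => Hs; rewrite -[RHS]Hs; congr (_ ^+ nat_of_bool _ * _).
by apply: eq_bigr => j _; rewrite ffunE.
Qed.

End Relations.

(** * Arcs between corners and the clash of parities *)

Definition all_but (c : 'I_3) : {ffun 'I_3 -> bool} := [ffun i => i != c].

(* The odd nodes strictly between the two corners [v_(d i)], [i != c]. *)
Definition opposite d (c : 'I_3) (j : nat) : bool :=
  odd j && (d * (c.+1 %% 3) <= j < d * (c.+1 %% 3).+1)%N.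

Lemma exists_I3 (P : pred 'I_3) :
  [exists i, P i] = [|| P (@Ordinal 3 0 isT), P (@Ordinal 3 1 isT) | P (@Ordinal 3 2 isT)].
Proof.
apply/existsP/or3P => [[[[|[|[|//]]] lt3] Pi] | [] Pi]; last by [exists (@Ordinal 3 2 isT)].
- by apply: Or31; rewrite (bool_irrelevance isT lt3).
- by apply: Or32; rewrite (bool_irrelevance isT lt3).
- by apply: Or33; rewrite (bool_irrelevance isT lt3).
- by exists (@Ordinal 3 0 isT).
- by exists (@Ordinal 3 1 isT).
Qed.

Section Parities.
Context {R : realType} {d : nat}.
Hypotheses (d_ge2 : (2 <= d)%N) (d_even : ~~ odd d).
Local Notation C := R[i].

Lemma opposite_rotated c (j : 'I_(3 * d)) :
  opposite d c (ord_pred j) (+) opposite d c (ordS j) = rotated (all_but c) j.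
Proof.
have [e de] : exists e, d = (2 * e)%N by exists d./2; rewrite mul2n even_halfK.
have jE := val_ordS _ (ord_pred j); rewrite ord_predK in jE.
have nE := val_ordS _ j; have jlt := ltn_ord j; have plt := ltn_ord (ord_pred j).
rewrite /rotated exists_I3 !ffunE.
move: (nat_of_ord (ord_pred j)) (nat_of_ord (ordS j)) (nat_of_ord j) jE nE jlt plt => p n k.
rewrite de => kE nE klt plt.
by case: c => [[|[|[|//]]] lt3]; rewrite /opposite -!val_eqE /= ?modnn ?modn_small //;
   move: kE nE; case: ifP => kd kE; case: ifP => nd nE; lia.
Qed.

(** The two rotations contribute i^2 = -1, which the sign of the outcome parity has to cancel. *)
Lemma even_parity_all_but c (m : {ffun 'I_(3 * d) -> bool}) :
  amp (all_but c) m != 0 :> C ->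
  \big[addb/false]_j (m j && (~~ odd j (+) opposite d c j)) = true.
Proof.
have o_odd (j : 'I_(3 * d)) : opposite d c j -> odd j by case/andP.
move=> /(even_parity d_ge2 d_even _ _ m o_odd (opposite_rotated c)).
have -> : \prod_i (if all_but c i then 'i%C else 1) = -1 :> C.
  rewrite !big_ord_recl big_ord0 !ffunE.
  by clear o_odd; case: c => [[|[|[|//]]] lt3]; rewrite /= ?mul1r ?mulr1 -expr2 sqr_i.
case: (\big[addb/false]_j _) => //= /eqP.
by rewrite mul1r -subr_eq0 -opprD oppr_eq0 -[1 + 1]/(2%:R) pnatr_eq0.
Qed.

Lemma even_parity_none (m : {ffun 'I_(3 * d) -> bool}) :
  amp [ffun=> false] m != 0 :> C -> \big[addb/false]_j (m j && ~~ odd j) = false.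
Proof.
have odd0 (j : 'I_(3 * d)) : pred0 j -> odd j by [].
have rot0 (j : 'I_(3 * d)) : false (+) false = rotated [ffun=> false] j.
  by rewrite /rotated exists_I3 !ffunE !andbF.
move=> /(even_parity d_ge2 d_even _ pred0 m odd0 rot0).
rewrite [\prod_i _]big1 => [|i _]; last by rewrite ffunE.
under eq_bigr do rewrite addbF.
case: (\big[addb/false]_j _) => //= /eqP.
by rewrite mulr1 -subr_eq0 -opprD oppr_eq0 -[1 + 1]/(2%:R) pnatr_eq0.
Qed.

Lemma no_local_assignment (x : {ffun 'I_3 -> bool} -> {ffun 'I_(3 * d) -> bool})
    (sees : 'I_(3 * d) -> 'I_3 -> bool) :
  (forall j (b b' : {ffun 'I_3 -> bool}), (forall i, sees j i -> b i = b' i) -> x b j = x b' j) ->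
  (forall j i i', sees j i -> sees j i' -> i = i') ->
  (forall c (j : 'I_(3 * d)), opposite d c j -> ~~ sees j c) ->
  (forall b, amp b (x b) != 0 :> C) -> False.
Proof.
move=> x_local sees_inj sees_opp amp_x.
pose zero : {ffun 'I_3 -> bool} := [ffun=> false].
pose one : {ffun 'I_3 -> bool} := [ffun=> true].
have := odd_parity d_ge2 d_even one (x one) (amp_x one).
have := even_parity_none (x zero) (amp_x zero).
have H c := even_parity_all_but c (x (all_but c)) (amp_x _).
have := H (@Ordinal 3 0 isT); have := H (@Ordinal 3 1 isT); have := H (@Ordinal 3 2 isT).
move=> {H} H2 H1 H0 Hz Ho.
(* The right-hand sides of the five constraints add up to 1, so it is enough that the left-hand
   sides cancel at each node. *)
suff : \big[addb/false]_j (
    (x (all_but (@Ordinal 3 2 isT)) j && (~~ odd j (+) opposite d (@Ordinal 3 2 isT) j)) (+)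
    ((x (all_but (@Ordinal 3 1 isT)) j && (~~ odd j (+) opposite d (@Ordinal 3 1 isT) j)) (+)
    ((x (all_but (@Ordinal 3 0 isT)) j && (~~ odd j (+) opposite d (@Ordinal 3 0 isT) j)) (+)
    ((x zero j && ~~ odd j) (+) (x one j && odd j))))) = false.
  by rewrite !big_split /= H0 H1 H2 Hz Ho.
rewrite big1 // => j _.
case: (boolP (odd j)) => oj /=.
  (* On the arc opposite to c an odd node ignores bit c, so [all_but c] and [one] give it the same
     output. The arcs partition the odd nodes, so [x one j] occurs twice. *)
  have opp_one c : x (all_but c) j && opposite d c j = x one j && opposite d c j.
    case: (boolP (opposite d c j)) => [/sees_opp jc | _]; last by rewrite !andbF.
    congr (_ && _); apply: x_local => i; rewrite !ffunE.
    by case: eqP => // -> jc'; rewrite jc' in jc.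
  rewrite !opp_one andbF andbT addFb.
  rewrite /opposite oj /= modnn !modn_small //.
  by have := ltn_ord j; case: (x one j) => //=; lia.
have noo c : opposite d c j = false by rewrite /opposite (negbTE oj).
rewrite !noo /= !andbT andbF addbF.
(* To this node the input clearing bit [i0] looks like [zero] and the other two of weight two like
   [one], so each value occurs twice. A node that sees no bit gets the default [ord0]. *)
have [i0 sees_i0] : exists i0, forall i, sees j i -> i = i0.
  case: (pickP (sees j)) => [i0 ji0 | none]; last by exists ord0 => i; rewrite none.
  by exists i0 => i ji; apply: sees_inj ji ji0.
have xE c : x (all_but c) j = if i0 != c then x one j else x zero j.
  by case: (eqVneq i0 c) => i0c; apply: x_local => i /sees_i0 ->;
     rewrite !ffunE ?i0c ?eqxx.
rewrite !xE; case: i0 {sees_i0 xE} => [[|[|[|//]]] lt3];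
  by rewrite -!val_eqE /=; case: (x one j); case: (x zero j).
Qed.

End Parities.

(** * Classical algorithms *)

Section Locality.
Context {d : nat}.

(* The radius-[t] ball around [w_i], meaningful for [t <= d./2]; the last
   disjunct is the wrap-around past [v_0]. *)
Definition sees (t : nat) (u : node d) (i : 'I_3) : bool :=
  match u with
  | inl j => ((j < d * i + t) && (d * i < j + t) || (3 * d + d * i < j + t))%N
  | inr k => k == i
  end.

(** The strict inequalities in [sees] account for the edge from w_i to its corner. As t < d/2, the
    corner v_{dl} can see no bit but b_l, so w_l learns nothing new from it. *)
Lemma sees_adj t (u w : node d) i :
  (t < d./2)%N -> netadj w u -> sees t w i -> sees t.+1 u i.
Proof.
move=> td; have {}td : (2 * t.+1 <= d)%N by have := odd_double_half d; lia.
have E3 (l : 'I_3) : [|| (l == 0 :> nat), (l == 1 :> nat) | (l == 2 :> nat)]%N.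
  by case: l => [[|[|[|//]]]].
case: w u => [k|l] [j|l'] //=.
- move=> kj; have {kj} : (nat_of_ord j == ordS k) || (nat_of_ord k == ordS j) := kj.
  rewrite !val_ordS; have := ltn_ord j; have := ltn_ord k.
  by have /or3P[] := E3 i => /eqP ->; case: ifP; case: ifP; lia.
- move=> /eqP ->; rewrite -val_eqE /=.
  by have /or3P[] := E3 i => /eqP ->; have /or3P[] := E3 l' => /eqP ->; lia.
- by move=> /eqP -> /eqP ->; lia.
Qed.

Lemma sees_mono t (u : node d) i : sees t u i -> sees t.+1 u i.
Proof. by case: u => //= j; lia. Qed.

Lemma cstate_local (Omega : Type) T (A : calg d Omega T)
    (b b' : {ffun 'I_3 -> bool}) om t (u : node d) :
  (t <= d./2)%N -> (forall i, sees t u i -> b i = b' i) ->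
  cstate A b om t u = cstate A b' om t u.
Proof.
elim: t u => [|t IHt] u td bb' /=.
  by case: u bb' => [j | k] //= bb'; rewrite bb' ?eqxx.
rewrite (IHt u (ltnW td)) => [|i /sees_mono /bb' //].
congr (cupd _); apply: functional_extensionality_dep => w.
case: ifP => // wu; rewrite (IHt w (ltnW td)) // => i /(sees_adj t u w i td wu).
exact: bb'.
Qed.

(** Corners are at distance d from each other, and a node sees only corners at distance less than t
    <= d/2. *)
Lemma sees_inj t j i i' : (t <= d./2)%N -> sees t (inl j) i -> sees t (inl j) i' -> i = i'.
Proof.
move=> td; have {}td : (2 * t <= d)%N by have := odd_double_half d; lia.
have := ltn_ord j => /= jd.
by case: i => [[|[|[|//]]] p]; case: i' => [[|[|[|//]]] p'] /= ? ?;
   apply: val_inj => //=; lia.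
Qed.

(** Every node of the arc is at distance at least d from the corner v_{dc}. *)
Lemma sees_opposite t c (j : 'I_(3 * d)) :
  (t <= d./2)%N -> opposite d c j -> ~~ sees t (inl j) c.
Proof.
move=> td; have {}td : (2 * t <= d)%N by have := odd_double_half d; lia.
rewrite /opposite => /andP[_]; have := ltn_ord j => /= jd.
by case: c => [[|[|[|//]]] p]; rewrite /= ?modnn ?modn_small //; lia.
Qed.

End Locality.

(** * Union bound over the eight inputs *)

Section ClassicalBound.
Local Open Scope classical_set_scope.

(** By [no_local_assignment], applied seed by seed, the eight failure events cover [Omega], so they
    cannot all have probability below 1/8. *)
Lemma classical_bound (R : realType) (d T : nat) dm (Omega : measurableType dm)
    (P : probability Omega R) (A : calg d Omega T) :
  (2 <= d)%N -> ~~ odd d -> (T <= d./2)%N ->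
  (forall b : {ffun 'I_3 -> bool}, measurable (csuccess R A b)) ->
  exists b : {ffun 'I_3 -> bool}, (P (csuccess R A b) <= (7 / 8 : R)%:E)%E.
Proof.
move=> d_ge2 d_even Td mS; apply: contrapT => /forallNP fail.
pose bs := enum {: {ffun 'I_3 -> bool}}.
have size_bs : size bs = 8%N by rewrite -cardE card_ffun card_bool card_ord.
(* Boole's inequality wants a sequence; beyond index 7, [nth] falls back to the input 000, so the
   facts below hold for every n. *)
pose F n := ~` csuccess R A (nth [ffun=> false] bs n).
have mF n : measurable (F n) by exact: measurableC.
have F_small n : (P (F n) < (1 / 8 : R)%:E)%E.
  have /negP := fail (nth [ffun=> false] bs n); rewrite -ltNge.
  rewrite probability_setC // -(@fineK _ (P (csuccess _ _ _))) ?fin_num_measure //.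
  by rewrite -EFinB !lte_fin; lra.
have F_cover : \big[setU/set0]_(n < 8) F n = setT.
  apply/seteqP; split => // om _; rewrite -bigcup_mkord; apply: contrapT => nF.
  apply: (@no_local_assignment R d d_ge2 d_even (fun b => coutput A b om)
            (fun j => sees T (inl j))).
  - move=> j b b' bb'; rewrite !ffunE.
    by rewrite (cstate_local _ _ _ _ b' _ _ _ Td).
  - by move=> j i i'; exact: sees_inj.
  - by move=> c j; exact: sees_opposite.
  - move=> b; rewrite -LambdaE; last exact: ltnW.
    apply: contrapT => nb; apply: nF; exists (index b bs) => /=.
      by rewrite -size_bs index_mem mem_enum.
    by rewrite /F nth_index ?mem_enum.
have : (1 <= \sum_(n < 8) P (F n))%E.
  by rewrite -(probability_setT P) -F_cover; exact: Boole_inequality.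
apply/negP; rewrite -ltNge.
have finF n : P (F n) = (fine (P (F n)))%:E by rewrite fineK // fin_num_measure.
under eq_bigr do rewrite finF.
rewrite sumEFin lte_fin.
have -> : 1 = \sum_(n < 8) (1 / 8 : R) by rewrite sumr_const card_ord -mulr_natr; lra.
apply: ltr_sum => [|n _]; first by apply/hasP; exists ord0; rewrite ?mem_index_enum.
by rewrite -lte_fin -finF.
Qed.

End ClassicalBound.

(** * The quantum algorithm *)

Section Quantum.
Context {R : realType} {d : nat}.
Hypothesis d_ge2 : (2 <= d)%N.
Local Notation C := R[i].

Lemma netadj_sym (u w : node d) : netadj u w = netadj w u.
Proof. by case: u w => [j|i] [k|l] //=; rewrite /cyc_adj orbC. Qed.

(* Messages between neighbours are single qubits, basis-indexed by ['I_2];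
   elsewhere ['I_1] makes them trivial. *)
Definition msg (u w : node d) (_ : nat) : finType := 'I_(netadj u w).+1.
Definition qubit (_ : node d) (_ : nat) : finType := bool.
Local Notation inbox u := {dffun forall w : node d, 'I_(netadj w u).+1}.
Local Notation outbox u := {dffun forall w : node d, 'I_(netadj u w).+1}.

Definition copy {n} (x : bool) : 'I_n.+1 := if x then ord_max else ord0.
(** A CNOT controlled by [x] where there is an edge: [rev_ord] flips a qubit, and it fixes a trivial
    message (n = 0). *)
Definition uncopy {n} (x : bool) (c : 'I_n.+1) : 'I_n.+1 := if x then rev_ord c else c.

Lemma uncopyK n x : uncopy x (copy x) = ord0 :> 'I_n.+1.
Proof. by case: x => //; apply: val_inj; rewrite /= subnn. Qed.

Lemma uncopy_inj n x : injective (@uncopy n x).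
Proof. by case: x => // c c'; exact: rev_ord_inj. Qed.

Lemma msg_dim_sym (u w : node d) : (netadj w u).+1 = (netadj u w).+1.
Proof. by rewrite netadj_sym. Qed.

Definition reply {u : node d} (c : inbox u) : outbox u :=
  [ffun w => cast_ord (msg_dim_sym u w) (c w)].

Lemma reply_inj u : injective (@reply u).
Proof.
move=> c c' /ffunP cc'; apply/ffunP => w.
by have := cc' w; rewrite !ffunE => /cast_ord_inj.
Qed.

Definition init_amp (u : node d) (x : bool) : C :=
  if u is inl _ then (Num.sqrt (2 : R))%:C%C^-1 else (~~ x)%:R.

(** v_k handles only its edges to smaller indices, so each edge is treated once; w_i applies S
    through its copy of v_{di}. *)
Definition phase (u : node d) (b : option bool) (x : bool) (c : inbox u) : C :=
  match u return inbox u -> C with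
  | inl k => fun c => \prod_(j : 'I_(3 * d) | (j < k)%N && @Gd_adj d j k)
                if x && (0 < c (inl j))%N then -1 else 1
  | inr i => fun c => \prod_(j : 'I_(3 * d) | nat_of_ord j == (d * i)%N)
                if (b == Some true) && (0 < c (inl j))%N then 'i%C else 1
  end c.

Definition prepare (u : node d) (o : bool * outbox u) : C :=
  init_amp u o.1 * (o.2 == [ffun w => copy o.1])%:R.

Definition answer (u : node d) (b : option bool) (o : bool * outbox u) (a : bool * inbox u) : C :=
  phase u b a.1 a.2 * (o == (a.1, reply a.2))%:R.

(** Uncopying returns the copies to |0>, so that no entanglement with them spoils the interference
    produced by H. *)
Definition finish (u : node d) (o : bool * inbox u) (a : bool * inbox u) : C :=
  Hgate R o.1 a.1 * (o.2 == [ffun w => uncopy a.1 (a.2 w)])%:R.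

Definition round_map (u : node d) (t : nat) (b : option bool) :
    (qubit u t.+1 * {dffun forall w : node d, msg u w t})%type -> qReg qubit msg u t -> C :=
  match t with
  | 0 => fun o _ => prepare u o
  | t'.+1 => fun o a => answer u b o a
  end.

(** * Isometry of the local maps *)

Lemma conj_unit (z : C) : `|z| = 1 -> z^* * z = 1.
Proof. by move=> z1; rewrite mulrC -normCK z1 expr1n. Qed.

Lemma norm_i : `|'i%C| = 1 :> C.
Proof.
by apply/eqP; rewrite -sqrp_eq1 // -normrX sqr_i normrN1.
Qed.

Lemma norm_phase u b x c : `|phase u b x c| = 1.
Proof.
by case: u c => [k|i] c /=; rewrite normr_prod big1 // => j _; case: ifP;
  rewrite ?normrN1 ?normr1 ?norm_i.
Qed.

Lemma sum_indicator (I : finType) (a : I) (F : I -> C) :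
  \sum_c F c * (c == a)%:R = F a.
Proof.
rewrite (bigD1 a) //= eqxx mulr1 big1 ?addr0 // => c /negbTE ->.
by rewrite mulr0.
Qed.

Lemma sqrt2_sqr : (Num.sqrt (2 : R))%:C%C * (Num.sqrt (2 : R))%:C%C = 2 :> C.
Proof. by rewrite -rmorphM /= -expr2 sqr_sqrtr // rmorphMn rmorph1. Qed.

Lemma sqrt2_conj : ((Num.sqrt (2 : R))%:C%C^-1)^* = (Num.sqrt (2 : R))%:C%C^-1 :> C.
Proof.
by rewrite rmorphV ?unitfE ?sqrt2_neq0 //= conj_Creal // ger0_real // ler0c sqrtr_ge0.
Qed.

Lemma sqrt2_half : (Num.sqrt (2 : R))%:C%C^-1 * (Num.sqrt (2 : R))%:C%C^-1 = 2^-1 :> C.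
Proof. by rewrite -invfM sqrt2_sqr. Qed.

Lemma Hgate_iso x x' : \sum_m (Hgate R m x)^* * Hgate R m x' = (x == x')%:R.
Proof.
rewrite big_bool /Hgate !rmorphM /= sqrt2_conj !(mulrACA _ (_^-1)) sqrt2_half.
rewrite -mulrDl; case: x; case: x';
  rewrite /= ?rmorphN ?rmorph1 ?mulrNN ?mul1r ?mulr1 ?addNr ?mul0r //;
  by apply: (@mulfV _ (2 : C)); rewrite pnatr_eq0.
Qed.

Lemma init_amp_norm u : \sum_x (init_amp u x)^* * init_amp u x = 1.
Proof.
rewrite big_bool; case: u => _ /=; last by rewrite conjC0 conjC1 mulr0 mulr1 add0r.
rewrite sqrt2_conj sqrt2_half -mulr2n -[RHS](@mulVf _ 2) ?pnatr_eq0 //.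
by rewrite mulr_natr.
Qed.

Lemma prepare_iso u : \sum_o (prepare u o)^* * prepare u o = 1.
Proof.
pose f x : outbox u := [ffun w => copy x].
rewrite -(init_amp_norm u).
transitivity (\sum_(o : bool * outbox u)
    (init_amp u o.1)^* * init_amp u o.1 * (o.2 == f o.1)%:R).
  apply: eq_bigr => [[x c] _]; rewrite /prepare /= -/(f x).
  by case: eqP => _; rewrite ?mulr1 ?mulr0.
rewrite -(pair_bigA _ (fun x (c : outbox u) =>
  (init_amp u x)^* * init_amp u x * (c == f x)%:R)) /=.
by apply: eq_bigr => x _; rewrite (sum_indicator _ _ (fun=> _)).
Qed.

Lemma answer_iso u b a a' : \sum_o (answer u b o a)^* * answer u b o a' = (a == a')%:R.
Proof.
rewrite (bigD1 (a.1, reply a.2)) //= big1 => [|o /negbTE oa]; last first.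
  by rewrite /answer oa mulr0 rmorph0 mul0r.
rewrite addr0 /answer eqxx mulr1.
have -> : ((a.1, reply a.2) == (a'.1, reply a'.2)) = (a == a').
  case: a a' => [x c] [x' c'] /=.
  by rewrite !xpair_eqE (inj_eq (@reply_inj u)).
case: eqP => [-> | _]; last by rewrite !mulr0.
by rewrite mulr1 conj_unit // norm_phase.
Qed.

Lemma finish_iso u a a' : \sum_o (finish u o a)^* * finish u o a' = (a == a')%:R.
Proof.
pose f (a : bool * inbox u) : inbox u := [ffun w => uncopy a.1 (a.2 w)].
transitivity (\sum_(o : bool * inbox u)
    (Hgate R o.1 a.1)^* * Hgate R o.1 a'.1 * (o.2 == f a')%:R * (o.2 == f a)%:R).
  apply: eq_bigr => [[x c] _]; rewrite /finish /= -/(f a) -/(f a').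
  by case: (c == f a); rewrite ?mulr1 ?mulr0 ?rmorph0 ?mul0r ?mulr1 ?mulrA.
rewrite -(pair_bigA _ (fun m (c : inbox u) => (Hgate R m a.1)^* * Hgate R m a'.1
    * (c == f a')%:R * (c == f a)%:R)) /=.
under eq_bigr do rewrite (sum_indicator _ (f a) (fun c => _ * (c == f a')%:R)).
rewrite -big_distrl Hgate_iso /= -natrM mulnb; congr (nat_of_bool _)%:R.
case: a a' => [x c] [x' c']; rewrite xpair_eqE /=; case: eqP => //= <-.
apply/eqP/eqP => [/ffunP cc' | -> //]; apply/ffunP => w.
by have := cc' w; rewrite !ffunE => /uncopy_inj.
Qed.

Lemma msg_triv u w t : ~~ netadj u w -> #|msg u w t| = 1%N.
Proof. by move=> /negbTE uw; rewrite card_ord uw. Qed.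

Lemma round_map_iso u t b : (t < 2)%N -> forall a a' : qReg qubit msg u t,
  \sum_o (@round_map u t b o a)^* * @round_map u t b o a' = (a == a')%:R.
Proof.
case: t => [|t] _ a a' /=; first by case: a a' => [] []; exact: prepare_iso.
exact: answer_iso.
Qed.

Definition copy_alg : qalg R d 2 :=
  @QAlg R d 2 qubit msg (fun u => (bool * inbox u)%type) msg_triv round_map round_map_iso
    (fun u _ => @finish u) (fun u _ => @finish_iso u) (fun u o => o.1).

(** * Global state, round by round *)

Local Notation config := {ffun node d -> bool}.

(* After round 1 each node holds copies of its neighbours' qubits, after round 2
   the returned copies of its own. *)
Definition conf1 (x : config) : {dffun forall u, qReg qubit msg u 1} :=
  [ffun u => (x u, [ffun w => copy (x w)])].
Definition conf2 (x : config) : {dffun forall u, qReg qubit msg u 2} :=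
  [ffun u => (x u, [ffun w => copy (x u)])].

Lemma conf1E x u : conf1 x u = (x u, [ffun w => copy (x w)] : inbox u).
Proof. by rewrite /conf1 ffunE. Qed.

Lemma conf2E x u : conf2 x u = (x u, [ffun w => copy (x u)] : inbox u).
Proof. by rewrite /conf2 ffunE. Qed.

Lemma qglobal1E b g :
  @qglobal R d 2 copy_alg b 1 g = \sum_(x : config) (\prod_u init_amp u (x u)) * (g == conf1 x)%:R.
Proof.
pose x0 : config := [ffun u => (g u).1].
transitivity ((\prod_u init_amp u (x0 u)) * (g == conf1 x0)%:R).
  rewrite /= (big_pred1 [ffun=> tt]) => [|f]; last first.
    by apply/esym/eqP/ffunP => u; case: (f u) => //; case: ([ffun=> tt] u).
  rewrite mulr1 /prepare /= big_split /= prod_indicator dffun_eqE.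
  congr (_ * _); first by apply: eq_bigr => u _; rewrite ffunE.
  congr (nat_of_bool _)%:R; apply/forallP/forallP => gE u; apply/eqP.
    rewrite conf1E [g u]surjective_pairing; congr (_, _); first by rewrite ffunE.
    apply/ffunP => w; rewrite [RHS]ffunE ffunE.
    by have /eqP/ffunP/(_ u) := gE w; rewrite !ffunE.
  apply/ffunP => w; rewrite !ffunE.
  by have /eqP -> := gE w; rewrite conf1E /= !ffunE.
rewrite [RHS](bigD1 x0) //= [X in _ = _ + X]big1 ?addr0 // => x xx0.
case: eqP => [gx | _]; last by rewrite mulr0.
case/eqP: xx0; apply/ffunP => u.
by rewrite [RHS]ffunE gx conf1E.
Qed.

(** [answer] is a phase times an injection of basis states, so [conf1 x] goes to the single basis
    state [conf2 x]. *)
Lemma qglobal2E b g :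
  @qglobal R d 2 copy_alg b 2 g = \sum_(x : config) (\prod_u init_amp u (x u)) *
    (\prod_u phase u (loc_input b u) (x u) [ffun w => copy (x w)]) * (g == conf2 x)%:R.
Proof.
transitivity (\sum_(g1 : {dffun forall u, qReg qubit msg u 1}) (\prod_u answer u (loc_input b u)
    ((g u).1, [ffun w => (g w).2 u]) (g1 u)) * @qglobal R d 2 copy_alg b 1 g1); first by [].
under eq_bigr do rewrite qglobal1E big_distrr.
rewrite exchange_big /=; apply: eq_bigr => x _.
under eq_bigr do rewrite mulrA.
rewrite sum_indicator mulrC -mulrA; congr (_ * _).
rewrite /answer big_split /= prod_indicator dffun_eqE; congr (_ * _).
  by apply: eq_bigr => u _; rewrite conf1E.
congr (nat_of_bool _)%:R; apply/forallP/forallP => gE u; apply/eqP.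
  rewrite conf2E [g u]surjective_pairing; congr (_, _).
    by have /eqP[-> _] := gE u; rewrite conf1E.
  apply/ffunP => w; rewrite [RHS]ffunE.
  have /eqP[_ /ffunP/(_ u)] := gE w; rewrite ffunE => ->.
  rewrite conf1E /reply !ffunE /= ?ffunE.
  by apply: val_inj; rewrite /= /copy netadj_sym; case: (x u).
rewrite conf1E /reply /=; congr (_, _); first by have /eqP -> := gE u; rewrite conf2E.
apply/ffunP => w; rewrite !ffunE /=.
have /eqP -> := gE w; rewrite conf2E /= ffunE.
by apply: val_inj; rewrite /= /copy netadj_sym; case: (x w).
Qed.

Lemma qfinalE b o :
  @qfinal R d 2 copy_alg b o = \sum_(x : config) (\prod_u init_amp u (x u)) *
    (\prod_u phase u (loc_input b u) (x u) [ffun w => copy (x w)]) *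
    (\prod_u Hgate R (o u).1 (x u)) * [forall u, (o u).2 == [ffun=> ord0]]%:R.
Proof.
rewrite /qfinal.
under eq_bigr do rewrite qglobal2E big_distrr.
rewrite exchange_big /=; apply: eq_bigr => x _.
under eq_bigr do rewrite mulrA.
rewrite sum_indicator mulrC -[RHS]mulrA; congr (_ * _).
rewrite /finish big_split /=; congr (_ * _).
  by apply: eq_bigr => u _; rewrite conf2E.
rewrite -prod_indicator; apply: eq_bigr => u _; congr (nat_of_bool (_ == _))%:R.
by apply/ffunP => w; rewrite conf2E !ffunE /= ?ffunE uncopyK.
Qed.

Lemma copy_gt0 n x : (0 < (copy x : 'I_n.+1))%N = x && (0 < n)%N.
Proof. by case: x. Qed.

(** These are the configurations of nonzero initial amplitude, since each w_i starts in |0>. *)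
Definition extend (y : {ffun 'I_(3 * d) -> bool}) : config :=
  [ffun u => if u is inl j then y j else false].

Lemma phase_extend b (y : {ffun 'I_(3 * d) -> bool}) :
  \prod_u phase u (loc_input b u) (extend y u) [ffun w => copy (extend y w)] =
  S_phase b y * CZ_phase y.
Proof.
rewrite big_sumType /= mulrC; congr (_ * _); apply: eq_bigr => k _.
  apply: eq_bigr => j kj; rewrite !ffunE copy_gt0 ?ffunE /= kj andbT.
  by rewrite (_ : (Some (b k) == Some true) = b k) //; case: (b k).
apply: eq_bigr => j /andP[_ jk]; rewrite !ffunE copy_gt0 ?ffunE /=.
by move: jk; rewrite /Gd_adj => ->; rewrite andbT.
Qed.

Lemma qfinal_amp b o :
  exists z, @qfinal R d 2 copy_alg b o = z * amp b (qoutput o).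
Proof.
(* The factors common to all summands: erasure of the copies, Hadamards of the w_i on |0>, initial
   amplitudes of the v_j. They depend on [o], but a zero of [amp] still gives a zero. *)
pose z : C := [forall u, (o u).2 == [ffun=> ord0]]%:R *
  (\prod_(i : 'I_3) Hgate R (o (inr i)).1 false) *
  \prod_(j : 'I_(3 * d)) (Num.sqrt (2 : R))%:C%C^-1.
exists z; rewrite qfinalE.
pose restrict (x : config) : {ffun 'I_(3 * d) -> bool} := [ffun j => x (inl j)].
rewrite (bigID (fun x => extend (restrict x) == x)) /= [X in _ + X]big1 ?addr0; last first.
  move=> x xE; suff -> : \prod_u init_amp u (x u) = 0 by rewrite !mul0r.
  suff [i xi] : exists i, x (inr i).
    by rewrite big_sumType /= [X in _ * X](bigD1 i) //= xi mul0r mulr0.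
  case: (pickP (fun i => x (inr i))) => [i xi | x0]; first by exists i.
  by case/eqP: xE; apply/ffunP => [[j|i]]; rewrite !ffunE // x0.
rewrite (reindex_onto extend restrict) => [|x /eqP //].
rewrite (eq_bigl predT) => [|y]; last first.
  have -> : restrict (extend y) = y by apply/ffunP => j; rewrite !ffunE.
  by rewrite !eqxx.
rewrite /amp big_distrr; apply: eq_bigr => y _.
rewrite phase_extend !big_sumType /= [\prod_(i < 3) _%:R]big1 => [|i _]; last first.
  by rewrite ffunE.
have -> : \prod_(i < 3) Hgate R (o (inr i)).1 (extend y (inr i)) =
          \prod_(i < 3) Hgate R (o (inr i)).1 false.
  by apply: eq_bigr => i _; rewrite ffunE.
have -> : \prod_(j < 3 * d) Hgate R (o (inl j)).1 (extend y (inl j)) =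
          \prod_(j < 3 * d) Hgate R (qoutput o j) (y j).
  by apply: eq_bigr => j _; rewrite !ffunE.
rewrite /z; ring.
Qed.

Lemma copy_alg_valid b : qfail_prob copy_alg b = 0.
Proof.
rewrite /qfail_prob big1 // => o.
rewrite LambdaE ?(ltnW d_ge2) // negbK => /eqP amp0.
by have [z ->] := qfinal_amp b o; rewrite amp0 mulr0 normr0 expr0n.
Qed.

End Quantum.

Theorem theorem4 (R : realType) (d : nat) :
  (2 <= d)%N -> ~~ odd d ->
  (* a 2-round quantum LOCAL algorithm always outputs a valid string *)
  (exists A : qalg R d 2, forall b : {ffun 'I_3 -> bool}, qfail_prob A b = 0)
  /\
  (* no T-round classical LOCAL algorithm, T <= d/2, even with arbitrary shared
     randomness, succeeds with probability > 7/8 on all inputs *)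
  (forall T : nat, (T <= d./2)%N ->
   forall (dm : measure_display) (Omega : measurableType dm)
          (P : probability Omega R) (A : calg d Omega T),
   (forall b : {ffun 'I_3 -> bool}, measurable (csuccess R A b)) ->
   exists b : {ffun 'I_3 -> bool}, (P (csuccess R A b) <= (7 / 8 : R)%:E)%E).
Proof.
move=> d_ge2 d_even; split.
  by exists copy_alg => b; exact: copy_alg_valid.
by move=> T Td dm Omega P A mS; exact: classical_bound.
Qed.
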